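(* Let $Y\subset\mathbb{P}^5$ be a cubic fourfold of type S6. Then $Y$ contains a singular point of corank at least $3$. Conversely, if $Y$ contains a singular point of corank $3$ or more, then $Y$ is of type S6.
   Context: We work over $\mathbb{C}$. A cubic fourfold is a hypersurface in $\mathbb{P}^5$ given by a nonzero cubic form in $x_0,\dots,x_5$. It is of type S6 if in suitable linear coordinates its equation is a linear combination of cubic monomials $x_0^{i_0}\cdots x_5^{i_5}$ of weight $\sum i_ja_j\le0$, where $(a_0,\dots,a_5)=(2,0,0,0,-1,-1)$; equivalently, its equation has the form $x_0q(x_4,x_5)+f(x_1,\dots,x_5)$ with $q$ a quadratic form and $f$ a cubic form. The corank of a hypersurface singularity $f(y_1,\dots,y_n)=0$ at the origin is $n$ minus the rank of the Hessian of $f$ at the origin (here $n=5$). *)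

(* Defs.v *)
From HB Require Import structures.
From mathcomp Require Import all_boot all_order all_algebra.
From mathcomp Require Import reals.
From mathcomp Require Import complex mpoly.

Set Implicit Arguments.
Unset Strict Implicit.
Unset Printing Implicit Defensive.

Import Order.TTheory GRing.Theory Num.Theory.
Local Open Scope ring_scope.

Section Defs.
Variable C : fieldType.

(* A hypersurface of P^5 is represented by its equation, and a point of P^5
   by a nonzero row vector of homogeneous coordinates. *)
Definition cubic_fourfold (f : {mpoly C[6]}) : Prop :=
  f != 0 /\ f \is 3.-homog.

(* The equation in the coordinates x' given by x = A x'. *)
Definition change_coord (A : 'M[C]_6) (f : {mpoly C[6]}) : {mpoly C[6]} :=
  f \mPo [tuple \sum_(k < 6) A j k *: 'X_k | j < 6].

Definition weightS6 : seq int := [:: 2; 0; 0; 0; -1; -1].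

Definition mweight (a : seq int) (m : 'X_{1..6}) : int :=
  \sum_(j < 6) (m j)%:Z * a`_j.

Definition type_S6 (f : {mpoly C[6]}) : Prop :=
  exists2 A : 'M[C]_6, A \in unitmx &
    forall m, m \in msupp (change_coord A f) -> mweight weightS6 m <= 0.

Definition singular_point (f : {mpoly C[6]}) (p : 'rV[C]_6) : Prop :=
  [/\ p != 0, f.@[p 0] = 0 & forall i : 'I_6, (f^`M(i)).@[p 0] = 0].

Definition hessian n (g : {mpoly C[n]}) (v : 'rV[C]_n) : 'M[C]_n :=
  \matrix_(i, j) (g^`M(i)^`M(j)).@[v 0].

Definition corank n (g : {mpoly C[n]}) : nat := (n - \rank (hessian g 0))%N.

(* The index of a standard affine chart containing p. *)
Definition chart (p : 'rV[C]_6) : 'I_6 := odflt ord0 [pick i | p 0 i != 0].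

(* The equation of f in the chart x_i = 1, i := chart p, with the five affine
   coordinates translated so that p becomes the origin.  The corank at the
   origin does not depend on the choice of a chart containing p, since p is
   only used below when it is singular on f. *)
Definition local_equation (f : {mpoly C[6]}) (p : 'rV[C]_6) : {mpoly C[5]} :=
  let i := chart p in
  f \mPo [tuple (p 0 j / p 0 i)%:MP + oapp (fun k : 'I_5 => 'X_k) 0 (unlift i j)
         | j < 6].

Definition corank_at (f : {mpoly C[6]}) (p : 'rV[C]_6) : nat :=
  corank (local_equation f p).

End Defs.

(* Main.v *)
(** At a singular point p of the cubic f, let H(p) be the 6 x 6 Hessian of f.
    By Euler's relation p H(p) = 2 grad f(p) and p grad f(p) = 3 f(p), so p is
    singular iff p lies in the kernel of H(p).  Deleting the row and column of
    a nonzero coordinate of p does not change the rank of H(p), and leaves the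
    local Hessian up to a scalar: the corank is 5 - rank H(p).  On the other
    hand, the entry (j, k) of the Hessian of f at the first coordinate point is
    a nonzero multiple of the coefficient of x_0 x_j x_k, so an equation has
    only monomials of nonpositive weight iff this Hessian vanishes outside its
    last 2 x 2 block.  Coordinates achieving this exist as soon as H(p) has
    rank at most 2: take a basis which starts with p and whose first four
    vectors lie in the kernel of H(p). *)

Require Import Defs.
From mathcomp Require Import all_boot all_order all_algebra.
From mathcomp Require Import reals.
From mathcomp Require Import complex mpoly.

Import Order.TTheory GRing.Theory Num.Theory.
Local Open Scope ring_scope.

Set Implicit Arguments.
Unset Strict Implicit.
Unset Printing Implicit Defensive.

Section Polynomials.

Variable F : numFieldType.

Lemma mpoly_subalg_ind n (P : {mpoly F[n]} -> Prop) :
    (forall c, P c%:MP) -> (forall i, P 'X_i) ->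
    (forall p q, P p -> P q -> P (p + q)) ->
    (forall p q, P p -> P q -> P (p * q)) ->
  forall p, P p.
Proof.
move=> PC PX PD PM p; rewrite [p]mpolyE.
apply: (big_ind P) => [|//|m _]; first by rewrite -mpolyC0; apply: PC.
rewrite -mul_mpolyC; apply: (PM _ _ (PC _)); rewrite mpolyXE_id.
apply: (big_ind P) => [|//|i _]; first by rewrite -mpolyC1; apply: PC.
elim: (m i) => [|k IHk]; first by rewrite expr0 -mpolyC1; apply: PC.
by rewrite exprS; apply: PM (PX i) IHk.
Qed.

Lemma mderiv_comp_mpoly n k (f : {mpoly F[n]}) (t : n.-tuple {mpoly F[k]})
    (i : 'I_k) :
  (f \mPo t)^`M(i) = \sum_j (f^`M(j) \mPo t) * (tnth t j)^`M(i).
Proof.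
elim/mpoly_subalg_ind: f => [c|l|p q IHp IHq|p q IHp IHq].
- rewrite comp_mpolyC mderivC big1 // => j _.
  by rewrite mderivC comp_mpoly0 mul0r.
- rewrite comp_mpolyXU -tnth_nth (bigD1 l) //= big1 => [|j neq_jl].
    rewrite mderivX mnm1E eqxx -{1}(add0m U_(l)%MM) addmK mpolyX0 scale1r.
    by rewrite comp_mpoly1 mul1r addr0.
  by rewrite mderivX mnm1E eq_sym (negPf neq_jl) scale0r comp_mpoly0 mul0r.
- rewrite comp_mpolyD mderivD IHp IHq -big_split /=; apply: eq_bigr => j _.
  by rewrite mderivD comp_mpolyD mulrDl.
rewrite rmorphM mderivM IHp IHq mulr_suml mulr_sumr -big_split /=.
apply: eq_bigr => j _; rewrite mderivM comp_mpolyD !rmorphM mulrDl.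
by rewrite mulrAC mulrA.
Qed.

Lemma dhomog_mdeg n d (p : {mpoly F[n]}) m :
  p \is d.-homog -> m \in msupp p -> mdeg m = d.
Proof. by move=> hp; apply: (dhomog_mf hp). Qed.

Lemma dhomog_mderiv n d (p : {mpoly F[n]}) (i : 'I_n) :
  p \is d.+1.-homog -> p^`M(i) \is d.-homog.
Proof.
move=> hp; apply/dhomogP => m; rewrite mcoeff_msupp mcoeff_mderiv.
rewrite mulrn_eq0 /= -mcoeff_msupp => /(dhomog_mdeg hp).
by rewrite mdegD mdeg1 addn1 => -[].
Qed.

Lemma dhomog_comp_mpoly n k d (p : {mpoly F[n]}) (t : n.-tuple {mpoly F[k]}) :
  p \is d.-homog -> (forall j, tnth t j \is 1.-homog) -> p \mPo t \is d.-homog.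
Proof.
move=> hp ht; rewrite comp_mpolyE big_seq; apply: rpred_sum => m m_p.
rewrite rpredZ // -(dhomog_mdeg hp m_p) mdegE.
pose ds := [tuple m i | i < n]; pose ps := [tuple tnth t i ^+ m i | i < n].
have hps i : tnth ps i \is (tnth ds i).-homog.
  by rewrite !tnth_mktuple -[X in X.-homog]mul1n dhomogMn.
have := dhomog_prod hps; rewrite !big_tuple.
have -> : (\sum_(i < n) tnth ds i = \sum_i m i)%N.
  by apply: eq_bigr => i _; rewrite tnth_mktuple.
rewrite [X in X \is _](eq_bigr (fun i => tnth t i ^+ m i)) // => i _.
by rewrite tnth_mktuple.
Qed.

Lemma euler_dhomog n d (p : {mpoly F[n]}) (v : 'I_n -> F) :
  p \is d.-homog -> \sum_i v i * (p^`M(i)).@[v] = d%:R * p.@[v].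
Proof.
move=> hp.
have eulerX (m : 'X_{1..n}) :
    \sum_i v i * ('X_[m]^`M(i)).@[v] = (mdeg m)%:R * ('X_[m]).@[v].
  rewrite mdegE natr_sum mulr_suml; apply: eq_bigr => i _.
  rewrite mderivX mevalZ mulrCA; case: (posnP (m i)) => [->|mi_gt0].
    by rewrite !mul0r.
  rewrite -[v i](mevalXU v) -mevalM -mpolyXD addmC submK //.
  by apply/mnm_lepP => j; rewrite mnm1E; case: eqP => // <-.
rewrite [in RHS](mpolyE p) [in RHS]raddf_sum mulr_sumr [RHS]big_seq.
rewrite [RHS](eq_bigr (fun m => \sum_i v i * (p@_m *: 'X_[m]^`M(i)).@[v])).
  rewrite -big_seq [RHS]exchange_big; apply: eq_bigr => i _.
  have ->: p^`M(i) = \sum_(m <- msupp p) p@_m *: 'X_[m]^`M(i).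
    by rewrite [in LHS](mpolyE p) linear_sum; apply: eq_bigr => m _; rewrite linearZ.
  by rewrite raddf_sum mulr_sumr.
move=> m m_p; rewrite /= mevalZ mulrCA -(dhomog_mdeg hp m_p) -eulerX mulr_sumr.
by apply: eq_bigr => i _; rewrite mevalZ mulrCA.
Qed.

Lemma meval_linear n (p : {mpoly F[n]}) (v : 'I_n -> F) :
  p \is 1.-homog -> p.@[v] = \sum_i p@_(U_(i)) * v i.
Proof.
move=> hp; rewrite -[LHS]mul1r -(euler_dhomog v hp); apply: eq_bigr => i _.
rewrite mulrC; congr (_ * _); have hpi := dhomog_mderiv i hp.
suff ->: p^`M(i) = (p@_(U_(i)))%:MP by rewrite mevalC.
apply/mpolyP => m; rewrite mcoeffC; case: eqVneq => [->|m_neq0].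
  by rewrite mcoeff_mderiv mnm0E add0m mulr1.
by rewrite mulr0 (dhomog_nemf_coeff hpi) // mdeg_eq0.
Qed.

Lemma hessian_sym n (f : {mpoly F[n]}) v : (hessian f v)^T = hessian f v.
Proof. by apply/matrixP => i j; rewrite !mxE mderiv_comm. Qed.

Lemma hessian_affine n k (f : {mpoly F[n]}) (t : n.-tuple {mpoly F[k]})
    (B : 'M_(k, n)) (v : 'rV_k) (w : 'rV_n) :
    (forall j i, (tnth t j)^`M(i) = (B i j)%:MP) ->
    (forall j, (tnth t j).@[v 0] = w 0 j) ->
  hessian (f \mPo t) v = B *m hessian f w *m B^T.
Proof.
move=> Dt tv; have D1 (g : {mpoly F[n]}) i :
    (g \mPo t)^`M(i) = \sum_j B i j *: (g^`M(j) \mPo t).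
  rewrite mderiv_comp_mpoly; apply: eq_bigr => j _.
  by rewrite Dt mulrC mul_mpolyC.
have D2 (g : {mpoly F[n]}) : (g \mPo t).@[v 0] = g.@[w 0].
  by rewrite comp_mpoly_meval; apply: meval_eq => j; rewrite tv.
apply/matrixP => a b; rewrite !mxE D1 (raddf_sum (mderiv b)) (raddf_sum (meval (v 0))) /=.
under [RHS]eq_bigr do rewrite mxE mulr_suml.
rewrite [RHS]exchange_big; apply: eq_bigr => j _.
rewrite mderivZ D1 mevalZ (raddf_sum (meval (v 0))) mulr_sumr; apply: eq_bigr => l _.
by rewrite /= mevalZ D2 !mxE mulrA mulrAC.
Qed.

Lemma hessian_scale n (f : {mpoly F[n]}) (c : F) (v : 'rV_n) :
  f \is 3.-homog -> hessian f (c *: v) = c *: hessian f v.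
Proof.
move=> hf; apply/matrixP => i j; rewrite !mxE.
rewrite !meval_linear ?dhomog_mderiv // mulr_sumr.
by apply: eq_bigr => k _; rewrite mxE mulrCA.
Qed.

Lemma hessian_delta n (f : {mpoly F[n]}) (i j k : 'I_n) :
  f \is 3.-homog ->
  (hessian f (delta_mx 0 i) j k == 0) = (f@_(U_(i) + U_(j) + U_(k)) == 0).
Proof.
move=> hf; rewrite mxE meval_linear ?dhomog_mderiv // (bigD1 i) //=.
rewrite big1 => [|l neq_li]; last by rewrite mxE (negPf neq_li) andbF mulr0.
rewrite mxE !eqxx mulr1 addr0 !mcoeff_mderiv.
by rewrite !mulrn_eq0 /= -!addmA (addmC U_(k)%MM).
Qed.

Lemma mulmx_hessian_grad n (f : {mpoly F[n]}) (v : 'rV_n) i :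
  f \is 3.-homog -> (v *m hessian f v) 0 i = 2%:R * (f^`M(i)).@[v 0].
Proof.
move=> hf; rewrite -(euler_dhomog _ (dhomog_mderiv i hf)) mxE.
by apply: eq_bigr => j _; rewrite mxE mderiv_comm.
Qed.

Lemma singular_point_hessian (f : {mpoly F[6]}) (p : 'rV_6) :
  f \is 3.-homog -> singular_point f p <-> p != 0 /\ p *m hessian f p = 0.
Proof.
move=> hf; split=> [[p_neq0 _ gradf]|[p_neq0 pH]].
  split=> //; apply/rowP => i.
  by rewrite mulmx_hessian_grad // gradf mulr0 mxE.
have gradf i : (f^`M(i)).@[p 0] = 0.
  have /eqP := mulmx_hessian_grad p i hf.
  by rewrite pH mxE eq_sym mulf_eq0 pnatr_eq0 => /eqP.
split=> //; have /eqP := euler_dhomog (p 0) hf.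
rewrite big1 => [|i _]; last by rewrite gradf mulr0.
by rewrite eq_sym mulf_eq0 pnatr_eq0 => /eqP.
Qed.

Lemma mxrank_row' n m (u : 'rV[F]_n) (M : 'M_(n, m)) (i : 'I_n) :
  u 0 i != 0 -> u *m M = 0 -> \rank (row' i M) = \rank M.
Proof.
move=> ui_neq0 uM; apply/eqP; rewrite eqn_leq; apply/andP; split.
  by apply: mxrankS; rewrite row'Esub; apply/row_subP => j; rewrite row_rowsub row_sub.
apply: mxrankS; have sub_row j : j != i -> (row j M <= row' i M)%MS.
  case: (unliftP i j) => [k ->|->]; last by rewrite eqxx.
  move=> _; rewrite (_ : row _ M = row k (row' i M)) ?row_sub //.
  by apply/rowP => l; rewrite !mxE.
apply/row_subP => j; have [->|/sub_row //] := eqVneq j i.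
have: u 0 i *: row i M = - \sum_(j | j != i) u 0 j *: row j M.
  apply/eqP; rewrite -subr_eq0 opprK -[X in _ == X]uM mulmx_sum_row.
  by rewrite [X in _ == X](bigD1 i).
move/(canRL (scalerK ui_neq0)) ->.
by rewrite scalemx_sub // eqmx_opp summx_sub // => l /sub_row; apply: scalemx_sub.
Qed.

Lemma row_free_extend k r n m (U : 'M[F]_(k, n)) (K : 'M_(m, n)) :
    row_free U -> (U <= K)%MS -> (k + r <= \rank K)%N ->
  exists2 V : 'M_(r, n), row_free (col_mx U V) & (V <= K)%MS.
Proof.
move=> freeU sUK le_kr; pose D := (K :\: U)%MS.
have rD : (r <= \rank D)%N.
  have := mxrank_cap_compl K U; rewrite (capmx_idPr sUK) (eqnP freeU) => rK.
  by rewrite -(leq_add2l k) rK.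
pose V : 'M_(r, n) := pid_mx r *m row_base D.
have sVD : (V <= D)%MS by rewrite (submx_trans (submxMl _ _)) ?eq_row_base.
exists V; last by rewrite (submx_trans sVD) ?diffmxSl.
apply/eqnP; rewrite -addsmxE mxrank_disjoint_sum; last first.
  by apply/eqP; rewrite -submx0 capmxC -(capmx_diff K U) capmxS.
by rewrite (eqnP freeU) mxrankMfree ?row_base_free // rank_pid_mx.
Qed.

Lemma corank_at_hessian (f : {mpoly F[6]}) (p : 'rV_6) :
    f \is 3.-homog -> singular_point f p ->
  corank_at f p = (5 - \rank (hessian f p))%N.
Proof.
move=> hf /(singular_point_hessian _ hf)[p_neq0 pH].
have pi_neq0 : p 0 (chart p) != 0.
  rewrite /chart; case: pickP => //= p0; case/eqP: p_neq0.
  by apply/rowP => i; apply/eqP; rewrite mxE -[_ == _]negbK p0.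
rewrite /corank_at /corank; congr (_ - _)%N; set i := chart p in pi_neq0 *.
have ci_neq0 : (p 0 i)^-1 != 0 by rewrite invr_eq0.
rewrite (@hessian_affine _ _ _ _ (rowsub (lift i) 1%:M) _ ((p 0 i)^-1 *: p)).
- rewrite hessian_scale // -scalemxAr -scalemxAl eqmx_scale //.
  set B := rowsub _ _; set H := hessian f p in pH *.
  have rkB m (M : 'M_(6, m)) : p *m M = 0 -> \rank (B *m M) = \rank M.
    by move=> pM; rewrite -rowsubE -row'Esub (mxrank_row' pi_neq0).
  rewrite -mulmxA rkB; last by rewrite mulmxA pH mul0mx.
  by rewrite -mxrank_tr trmx_mul trmxK hessian_sym rkB.
- move=> j k; rewrite tnth_mktuple mderivD mderivC add0r !mxE.
  case: unliftP => [l|] -> /=.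
    rewrite mderivX mnm1E (inj_eq lift_inj) eq_sym; case: eqVneq => [->|_].
      by rewrite -{1}(add0m U_(l)%MM) addmK mpolyX0 scale1r.
    by rewrite scale0r.
  by rewrite raddf0 eq_sym (negPf (neq_lift _ _)).
move=> j; rewrite tnth_mktuple mevalD mevalC mxE mulrC -[RHS]addr0.
congr (_ + _); case: (unlift i j) => [l|] /=; last by rewrite meval0.
by rewrite mevalXU mxE.
Qed.

Lemma hessian_change_coord (A : 'M_6) (f : {mpoly F[6]}) (v : 'rV_6) :
  hessian (change_coord A f) v = A^T *m hessian f (v *m A^T) *m A.
Proof.
rewrite (@hessian_affine _ _ _ _ A^T _ (v *m A^T)) ?trmxK // => [j i|j].
  rewrite tnth_mktuple raddf_sum (bigD1 i) //= big1 => [|k neq_ki].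
    rewrite mderivZ mderivX mnm1E eqxx -{1}(add0m U_(i)%MM) addmK mpolyX0.
    by rewrite scale1r addr0 mxE -mul_mpolyC mulr1.
  by rewrite mderivZ mderivX mnm1E (negPf neq_ki) scale0r scaler0.
rewrite tnth_mktuple (raddf_sum (meval (v 0))) mxE; apply: eq_bigr => k _.
by rewrite /= mevalZ mevalXU mxE mulrC.
Qed.

Lemma change_coord_dhomog d (A : 'M_6) (f : {mpoly F[6]}) :
  f \is d.-homog -> change_coord A f \is d.-homog.
Proof.
move=> hf; apply: dhomog_comp_mpoly => // j; rewrite tnth_mktuple.
by apply: rpred_sum => k _; rewrite rpredZ // dhomogX; apply/eqP/mdeg1.
Qed.

Lemma mweightD a (m1 m2 : 'X_{1..6}) :
  Defs.mweight a (m1 + m2)%MM = Defs.mweight a m1 + Defs.mweight a m2.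
Proof.
by rewrite -big_split; apply: eq_bigr => i _; rewrite mnmDE PoszD mulrDl.
Qed.

Lemma mweightU a (i : 'I_6) : Defs.mweight a U_(i)%MM = a`_i.
Proof.
rewrite /Defs.mweight (bigD1 i) //= big1 => [|j neq_ji].
  by rewrite mnm1E eqxx mul1r addr0.
by rewrite mnm1E eq_sym (negPf neq_ji) mul0r.
Qed.

Lemma mdegS_split n d (m : 'X_{1..n}) :
  mdeg m = d.+1 -> exists i m', m = (U_(i) + m')%MM /\ mdeg m' = d.
Proof.
move=> dm; have [i mi|m0] := pickP (fun i => m i != 0%N).
  exists i, (m - U_(i))%MM; have Dm : m = (U_(i) + (m - U_(i)))%MM.
    by rewrite addmC submK // lep1mP.
  by split=> //; move: dm; rewrite {1}Dm mdegD mdeg1 add1n => -[].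
by move: dm; rewrite mdegE big1 // => i _; apply/eqP/negbFE/m0.
Qed.

Lemma weightS6_hessian (g : {mpoly F[6]}) :
    g \is 3.-homog ->
  (forall m, m \in msupp g -> Defs.mweight weightS6 m <= 0) <->
  (forall i : 'I_6, (i < 4)%N -> row i (hessian g (delta_mx 0 ord0)) = 0).
Proof.
move=> hg; have w0 j k : Defs.mweight weightS6 (U_(ord0) + U_(j) + U_(k))%MM <= 0 ->
    (4 <= j)%N && (4 <= k)%N.
  rewrite !mweightD !mweightU.
  by case: j k => [[|[|[|[|[|[|j]]]]]] ltj6] [[|[|[|[|[|[|k]]]]]] ltk6].
have w4 (j k : 'I_6) :
    (4 <= j)%N -> (4 <= k)%N -> Defs.mweight weightS6 (U_(ord0) + U_(j) + U_(k))%MM <= 0.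
  rewrite !mweightD !mweightU.
  by case: j k => [[|[|[|[|[|[|j]]]]]] ltj6] [[|[|[|[|[|[|k]]]]]] ltk6].
split=> [wg j lt_j4|Hg m m_g].
  apply/rowP => k; rewrite mxE [RHS]mxE; apply/eqP; rewrite hessian_delta //.
  apply/negPn/negP; rewrite -mcoeff_msupp => /wg/w0.
  by rewrite leqNgt lt_j4.
have [m00|m0_gt0] := posnP (m ord0).
  rewrite /Defs.mweight big_ord_recl m00 mul0r add0r; apply: sumr_le0 => i _.
  by rewrite mulr_ge0_le0 //; case: i => [[|[|[|[|[|i]]]]] lti5].
have Dm : m = (U_(ord0) + (m - U_(ord0)))%MM.
  by rewrite addmC submK // lep1mP -lt0n.
have := dhomog_mdeg hg m_g; rewrite {1}Dm mdegD mdeg1 add1n => -[].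
case/mdegS_split=> j [m1 [Dm1]] /eqP/mdeg1P[k /eqP Dk].
move: m_g; rewrite {}Dm {}Dm1 {}Dk addmA mcoeff_msupp -hessian_delta // => Hjk.
have H4 (a b : 'I_6) : hessian g (delta_mx 0 ord0) a b != 0 -> (4 <= a)%N.
  apply: contra_neqT; rewrite -ltnNge => /Hg/rowP/(_ b).
  by rewrite mxE [RHS]mxE.
by rewrite w4 ?(H4 j k) // (H4 k j) // -hessian_sym mxE.
Qed.

Lemma type_S6_hessian (f : {mpoly F[6]}) :
    f \is 3.-homog ->
  type_S6 f <->
  exists p, [/\ p != 0, p *m hessian f p = 0 & (\rank (hessian f p) <= 2)%N].
Proof.
move=> hf; split=> [[A Aunit]|[p [p_neq0 pH rkH]]].
  have hg := change_coord_dhomog A hf.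
  move/(weightS6_hessian hg); set e0 : 'rV_6 := delta_mx 0 ord0.
  rewrite hessian_change_coord; set p := e0 *m A^T; set H := hessian f p => G0.
  have ATunit : A^T \in unitmx by rewrite unitmx_tr.
  exists p; split.
  - apply/eqP => /(congr1 (mulmx^~ (invmx A^T))); rewrite mulmxK // mul0mx.
    by move/rowP/(_ ord0); rewrite !mxE !eqxx => /eqP; rewrite oner_eq0.
  - have := G0 ord0 isT; rewrite rowE -/e0 mulmxA => /(canRL (mulmxK Aunit)).
    by rewrite mul0mx mulmxA.
  have ->: \rank H = \rank (A^T *m H *m A).
    by rewrite mxrankMfree ?row_free_unit // eqmxMfull ?row_full_unit.
  set G : 'M_(4 + 2, 6) := A^T *m H *m A in G0 *.
  have uG0 : usubmx G = 0.
    apply/row_matrixP => i; rewrite row0 -(G0 (lshift 2 i) (ltn_ord i)).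
    by apply/rowP => j; rewrite !mxE.
  suff: (\rank (col_mx (usubmx G) (dsubmx G)) <= 2)%N by rewrite vsubmxK.
  by rewrite uG0 -addsmxE adds0mx rank_leq_row.
set H := hessian f p in pH rkH.
have sp : (p <= kermx H)%MS by apply/sub_kermxP.
have p_free : row_free p by rewrite /row_free rank_rV p_neq0.
have [|V pV_free sVK] := row_free_extend (r := 3) p_free sp.
  by rewrite mxrank_ker; case: (\rank H) rkH => [|[|[|]]].
have [|W B_free _] := row_free_extend (r := 2) pV_free (submx1 _).
  by rewrite mxrank1.
pose B : 'M_6 := col_mx (col_mx p V) W.
exists B^T; first by rewrite unitmx_tr -row_free_unit.
apply/weightS6_hessian; first exact: change_coord_dhomog.
move=> i lt_i4; rewrite hessian_change_coord !trmxK.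
have rowB (j : 'I_(1 + 3)) : row (lshift 2 j) B = row j (col_mx p V).
  by apply/rowP => k; rewrite !mxE (unsplitK (inl j)) !mxE.
have ->: delta_mx 0 ord0 *m B = p.
  rewrite -rowE; have ->: ord0 = lshift 2 (lshift 3 (ord0 : 'I_1)).
    exact: val_inj.
  by rewrite rowB; apply/rowP => k; rewrite !mxE (unsplitK (inl ord0)) .
rewrite -/H row_mul row_mul.
have ->: i = lshift 2 (Ordinal lt_i4) by apply: val_inj.
suff /sub_kermxP ->: (row (lshift 2 (Ordinal lt_i4)) B <= kermx H)%MS.
  by rewrite mul0mx.
by rewrite rowB (submx_trans (row_sub _ _)) // col_mx_sub sp.
Qed.

End Polynomials.

Theorem lemma3p7 (R : realType) (f : {mpoly R[i][6]}) (hf : cubic_fourfold f) :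
  (type_S6 f ->
     exists p : 'rV[R[i]]_6, singular_point f p /\ (3 <= corank_at f p)%N) /\
  ((exists p : 'rV[R[i]]_6, singular_point f p /\ (3 <= corank_at f p)%N) ->
     type_S6 f).
Proof.
case: hf => _ hf; split=> [/(type_S6_hessian hf)[p [p_neq0 pH rkH]]|].
  have p_sing : singular_point f p by apply/singular_point_hessian.
  by exists p; rewrite corank_at_hessian //; case: (\rank _) rkH => [|[|[|]]].
case=> p [p_sing]; rewrite corank_at_hessian // => rkH.
have [p_neq0 pH] := (singular_point_hessian p hf).1 p_sing.
apply/type_S6_hessian => //; exists p; split=> //.
by case: (\rank _) rkH => [|[|[|[|[|]]]]].
Qed.
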